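(* Consider the time-varying main effect matrix factor model (MEFM) described in the context, and suppose the Centering condition holds. Then each $\mu_t$, $\boldsymbol{\alpha}_t$ and $\boldsymbol{\beta}_t$ ($t\in[T]$) is identified, and hence the common component $\mathbf{C}_t$ is identified. If in addition the Loading condition is satisfied, then the factor structure is identified up to an invertible transformation: $(\mathbf{Q}_r,\mathbf{Q}_c,\mathbf{F}_{Z,t})$ is identified up to replacement by $(\mathbf{Q}_r\mathbf{M}_r,\ \mathbf{Q}_c\mathbf{M}_c,\ \mathbf{M}_r^{-1}\mathbf{F}_{Z,t}(\mathbf{M}_c')^{-1})$ for some invertible matrices $\mathbf{M}_r\in\mathbb{R}^{k_r\times k_r}$ and $\mathbf{M}_c\in\mathbb{R}^{k_c\times k_c}$. Here ''identified'' means: if another set of parameters $(\widetilde\mu_t,\widetilde{\boldsymbol{\alpha}}_t,\widetilde{\boldsymbol{\beta}}_t,\widetilde{\mathbf{Q}}_r,\widetilde{\mathbf{Q}}_c,\widetilde{\mathbf{F}}_{Z,t})$, $t\in[T]$, satisfies the same model equation (same $\mathbf{Y}_t$, same $\mathbf{E}_t$) and the same conditions, then $\widetilde\mu_t=\mu_t$, $\widetilde{\boldsymbol{\alpha}}_t=\boldsymbol{\alpha}_t$, $\widetilde{\boldsymbol{\beta}}_t=\boldsymbol{\beta}_t$, $\widetilde{\mathbf{Q}}_r\widetilde{\mathbf{F}}_{Z,t}\widetilde{\mathbf{Q}}_c'=\mathbf{Q}_r\mathbf{F}_{Z,t}\mathbf{Q}_c'$ and, under the Loading condition, the two triples $(\widetilde{\mathbf{Q}}_r,\widetilde{\mathbf{Q}}_c,\widetilde{\mathbf{F}}_{Z,t})$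 and $(\mathbf{Q}_r,\mathbf{Q}_c,\mathbf{F}_{Z,t})$ are related by the displayed transformation.
   Context: Notation: $[m]=\{1,\dots,m\}$; $\mathbf{1}_m$ is the vector of $m$ ones; $'$ is transpose; $\mathrm{diag}(\mathbf{A})$ is the diagonal matrix with the diagonal of $\mathbf{A}$; $a\asymp b$ means $a=O(b)$ and $b=O(a)$. Model (MEFM): for $t\in[T]$, the observed $\mathbf{Y}_t\in\mathbb{R}^{p\times q}$ satisfies $$\mathbf{Y}_t=\mu_t\mathbf{1}_p\mathbf{1}_q'+\boldsymbol{\alpha}_t\mathbf{1}_q'+\mathbf{1}_p\boldsymbol{\beta}_t'+\mathbf{C}_t+\mathbf{E}_t,\qquad \mathbf{C}_t=\mathbf{A}_r\mathbf{F}_t\mathbf{A}_c',$$ with scalar grand mean $\mu_t$, row effects $\boldsymbol{\alpha}_t\in\mathbb{R}^p$, column effects $\boldsymbol{\beta}_t\in\mathbb{R}^q$, latent random core factor series $\mathbf{F}_t\in\mathbb{R}^{k_r\times k_c}$, loading matrices $\mathbf{A}_r\in\mathbb{R}^{p\times k_r}$, $\mathbf{A}_c\in\mathbb{R}^{q\times k_c}$, and noise $\mathbf{E}_t\in\mathbb{R}^{p\times q}$. Put $\mathbf{Z}_r=\mathrm{diag}(\mathbf{A}_r'\mathbf{A}_r)$, $\mathbf{Z}_c=\mathrm{diag}(\mathbf{A}_c'\mathbf{A}_c)$, $\mathbf{Q}_r=\mathbf{A}_r\mathbf{Z}_r^{-1/2}$, $\mathbf{Q}_c=\mathbf{A}_c\mathbf{Z}_c^{-1/2}$,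 $\mathbf{F}_{Z,t}=\mathbf{Z}_r^{1/2}\mathbf{F}_t\mathbf{Z}_c^{1/2}$, so $\mathbf{C}_t=\mathbf{Q}_r\mathbf{F}_{Z,t}\mathbf{Q}_c'$. Centering condition: for every $t\in[T]$, $\mathbf{1}_p'\boldsymbol{\alpha}_t=\mathbf{1}_q'\boldsymbol{\beta}_t=0$, $\mathbf{1}_p'\mathbf{A}_r=\mathbf{0}$ and $\mathbf{1}_q'\mathbf{A}_c=\mathbf{0}$. Loading condition: $\mathbf{A}_r,\mathbf{A}_c$ are of full rank and independent of the factor and error series. As $p,q\to\infty$, $\mathbf{Z}_r^{-1/2}\mathbf{A}_r'\mathbf{A}_r\mathbf{Z}_r^{-1/2}\to\boldsymbol{\Sigma}_{A,r}$ and $\mathbf{Z}_c^{-1/2}\mathbf{A}_c'\mathbf{A}_c\mathbf{Z}_c^{-1/2}\to\boldsymbol{\Sigma}_{A,c}$, both positive definite with all eigenvalues bounded away from $0$ and infinity. Moreover $(\mathbf{Z}_r)_{jj}\asymp p^{\delta_{r,j}}$ for $j\in[k_r]$ with $1/2<\delta_{r,k_r}\le\dots\le\delta_{r,1}\le1$, and $(\mathbf{Z}_c)_{jj}\asymp q^{\delta_{c,j}}$ for $j\in[k_c]$ with $1/2<\delta_{c,k_c}\le\dots\le\delta_{c,1}\le1$.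
   Formalization: The factor-structure claim is asserted at almost every outcome where the realised F_1,...,F_T span (no nonzero u with u'F_t=0 for all t, no nonzero v with F_t v=0 for all t); without nondegeneracy it fails, e.g. for F_t=0. Also p,q≥1. *)

(* Defs.v *)
(* MathComp / MathComp-Analysis. *)
From HB Require Import structures.
From mathcomp Require Import all_boot all_order all_algebra.
From mathcomp Require Import all_classical all_reals all_analysis.

Set Implicit Arguments.
Unset Strict Implicit.
Unset Printing Implicit Defensive.

Import Order.TTheory GRing.Theory Num.Theory.
Import numFieldNormedType.Exports.

Local Open Scope classical_set_scope.
Local Open Scope ring_scope.

(** * Diagonal normalisation of a loading matrix *)

Section Normalisation.
Variables (R : realType) (m k : nat).
Implicit Type A : 'M[R]_(m, k).

Definition Zmx A : 'M[R]_k := diag_mx (\row_j (A^T *m A) j j).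

Definition Zsqrt A : 'M[R]_k := diag_mx (\row_j Num.sqrt (Zmx A j j)).

(* The inverse is taken entrywise on the diagonal, with 0^-1 = 0: a zero column
   of A stays a zero column of Qmx A, so that A = Qmx A *m Zsqrt A always. *)
Definition Zisqrt A : 'M[R]_k := diag_mx (\row_j (Num.sqrt (Zmx A j j))^-1).

Definition Qmx A : 'M[R]_(m, k) := A *m Zisqrt A.

Definition normalised_gram A : 'M[R]_k := Zisqrt A *m (A^T *m A) *m Zisqrt A.

End Normalisation.

Definition positive_definite (R : realType) (k : nat) (S : 'M[R]_k) : Prop :=
  S^T = S /\ forall x : 'cV[R]_k, x != 0 -> 0 < (x^T *m S *m x) 0 0.

(** * Random matrices *)

Section RandomMatrices.
Context (d : measure_display) (Omega : measurableType d) (R : realType).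

Definition random_matrix (m n : nat) (X : Omega -> 'M[R]_(m, n)) : Prop :=
  forall i j, measurable_fun setT (fun w => X w i j).

(* The events {X_ij \in B}, B Borel; they generate the sigma-algebra of X. *)
Definition entry_events (m n : nat) (X : Omega -> 'M[R]_(m, n)) :
    set (set Omega) :=
  [set S | exists i j (B : set R),
     measurable B /\ S = (fun w => X w i j) @^-1` B].

(* Independence of the sigma-algebras generated by two families of events. *)
Definition independent_sigma (P : probability Omega R) (G H : set (set Omega)) :
    Prop :=
  forall S U : set Omega, <<s G >> S -> <<s H >> U ->
    P (S `&` U) = (P S * P U)%E.

End RandomMatrices.

(** * The time-varying main effect matrix factor model *)

(* Time runs over 'I_T.  Main effects and loadings are functions of the outcome
   as well; nonrandom ones are the constant functions. *)
Record mefm (Omega : Type) (R : realType) (T p q kr kc : nat) := Mefm {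
  mu    : 'I_T -> Omega -> R;
  alpha : 'I_T -> Omega -> 'cV[R]_p;
  beta  : 'I_T -> Omega -> 'cV[R]_q;
  Ar    : Omega -> 'M[R]_(p, kr);
  Ac    : Omega -> 'M[R]_(q, kc);
  Ft    : 'I_T -> Omega -> 'M[R]_(kr, kc)
}.

Definition ones (R : realType) (m : nat) : 'cV[R]_m := const_mx 1.

Section Components.
Variables (Omega : Type) (R : realType) (T p q kr kc : nat).
Variable th : mefm Omega R T p q kr kc.

Definition common (t : 'I_T) (w : Omega) : 'M[R]_(p, q) :=
  Ar th w *m Ft th t w *m (Ac th w)^T.

Definition Qr (w : Omega) : 'M[R]_(p, kr) := Qmx (Ar th w).

Definition Qc (w : Omega) : 'M[R]_(q, kc) := Qmx (Ac th w).

Definition FZ (t : 'I_T) (w : Omega) : 'M[R]_(kr, kc) :=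
  Zsqrt (Ar th w) *m Ft th t w *m Zsqrt (Ac th w).

(* No direction of R^kr (resp. R^kc) is absent from the realised factor series:
   [F_1 ... F_T] and [F_1' ... F_T'] have full row rank at the outcome w.
   Where this fails, e.g. at F_1 = ... = F_T = 0, the model equation does not
   determine the column spaces of the loadings. *)
Definition factors_span (w : Omega) : Prop :=
  (forall u : 'rV[R]_kr, (forall t, u *m Ft th t w = 0) -> u = 0) /\
  (forall v : 'cV[R]_kc, (forall t, Ft th t w *m v = 0) -> v = 0).

End Components.

Section Model.
Context (d : measure_display) (Omega : measurableType d) (R : realType).
Variable P : probability Omega R.
Variables (T kr kc : nat).

Definition satisfies_model (p q : nat) (Y E : 'I_T -> Omega -> 'M[R]_(p, q))
    (th : mefm Omega R T p q kr kc) : Prop :=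
  [/\ forall t, random_matrix (Ft th t),
      forall t, random_matrix (E t) &
      forall t, \forall w \ae P,
        Y t w = mu th t w *: (ones R p *m (ones R q)^T)
                + alpha th t w *m (ones R q)^T
                + ones R p *m (beta th t w)^T
                + common th t w + E t w].

Definition centering_condition (p q : nat) (th : mefm Omega R T p q kr kc) :
    Prop :=
  [/\ forall t, \forall w \ae P, (ones R p)^T *m alpha th t w = 0,
      forall t, \forall w \ae P, (ones R q)^T *m beta th t w = 0,
      \forall w \ae P, (ones R p)^T *m Ar th w = 0 &
      \forall w \ae P, (ones R q)^T *m Ac th w = 0].

(* Rank, Gram-limit and factor-strength requirements on one sequence of loading
   matrices A n of heights m n. *)
Definition regular_loadings (k : nat) (m : nat -> nat)
    (A : forall n, Omega -> 'M[R]_(m n, k)) : Prop :=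
  [/\ forall n, \forall w \ae P, \rank (A n w) = minn (m n) k,
      exists Sigma : 'M[R]_k,
        [/\ positive_definite Sigma,
            exists c C : R, 0 < c /\
              forall l : R, eigenvalue Sigma l -> c <= l <= C &
            \forall w \ae P,
              (fun n => normalised_gram (A n w)) @ \oo --> Sigma] &
      exists delta : 'I_k -> R,
        [/\ forall i j : 'I_k, (i <= j)%N -> delta j <= delta i,
            forall j, 2^-1 < delta j <= 1 &
            forall j, \forall w \ae P,
              (fun n => Zmx (A n w) j j) =O_\oo
                (fun n => (m n)%:R `^ delta j) /\
              (fun n => (m n)%:R `^ delta j) =O_\oo
                (fun n => Zmx (A n w) j j)]].

(* "p, q -> oo" is a sequence of models of dimensions (p n, q n). *)
Definition loading_condition (p q : nat -> nat)
    (E : forall n, 'I_T -> Omega -> 'M[R]_(p n, q n))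
    (th : forall n, mefm Omega R T (p n) (q n) kr kc) : Prop :=
  [/\ forall n, random_matrix (Ar (th n)) /\ random_matrix (Ac (th n)),
      forall n, independent_sigma P
        (entry_events (Ar (th n)) `|` entry_events (Ac (th n)))
        (\bigcup_t (entry_events (Ft (th n) t) `|` entry_events (E n t))),
      regular_loadings (fun n => Ar (th n)) &
      regular_loadings (fun n => Ac (th n))].

End Model.

(* Main.v *)
Require Import Defs.
From HB Require Import structures.
From mathcomp Require Import all_boot all_order all_algebra.
From mathcomp Require Import all_classical all_reals all_analysis.
From mathcomp Require Import zify.

Set Implicit Arguments.
Unset Strict Implicit.
Unset Printing Implicit Defensive.

Import Order.TTheory GRing.Theory Num.Theory.
Import numFieldNormedType.Exports.
Local Open Scope classical_set_scope.
Local Open Scope ring_scope.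

(** Multiplying the model equation by vectors of ones kills every centred term,
so the overall sum of an outcome gives the grand mean, its row and column sums
give the main effects, and the common component is what remains.

A centred loading matrix is not row free, so "full rank" means full column rank.
Since the factors span, the columns of [C_1 ... C_T] span the column space of
[Ar]; they lie in the column space of the other row loading matrix, which has the
same dimension, so the two loading matrices differ by an invertible factor, and
similarly for columns with [C_t']. Cancelling the loadings on both sides of the
common component relates the factors. *)

(** * Diagonal normalisation of a loading matrix *)

Section Normalisation.
Variables (R : realType) (m k : nat).
Implicit Type A : 'M[R]_(m, k).

Lemma Zmx_diag A j : Zmx A j j = \sum_i A i j ^+ 2.
Proof.
rewrite /Zmx !mxE eqxx mulr1n.
by apply: eq_bigr => i _; rewrite mxE expr2.
Qed.

Lemma Zmx_diag_ge0 A j : 0 <= Zmx A j j.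
Proof. by rewrite Zmx_diag sumr_ge0 // => i _; rewrite sqr_ge0. Qed.

Lemma Zmx_diag_eq0 A j : Zmx A j j = 0 -> forall i, A i j = 0.
Proof.
rewrite Zmx_diag => /eqP; rewrite psumr_eq0; last by move=> i _; rewrite sqr_ge0.
by move/allP => A0 i; apply/eqP; rewrite -sqrf_eq0; apply: A0 (mem_index_enum i).
Qed.

(** A diagonal entry of [Zmx A] is the squared norm of a column, so the default value of the inverse
    at 0 is met only where the column of [A] is zero. *)
Lemma Qmx_Zsqrt A : Qmx A *m Zsqrt A = A.
Proof.
rewrite /Qmx /Zisqrt /Zsqrt -mulmxA mulmx_diag; apply/matrixP => i j.
rewrite mul_mx_diag mxE [X in _ * X]mxE.
rewrite [X in _ * (X * _)]mxE [X in _ * (_ * X)]mxE.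
have [s0|s_neq0] := eqVneq (Num.sqrt (Zmx A j j)) 0.
  rewrite (@Zmx_diag_eq0 A j) ?mul0r //.
  by apply/eqP; rewrite eq_le Zmx_diag_ge0 andbT -sqrtr_eq0 s0.
by rewrite mulVf // mulr1.
Qed.

Lemma Zsqrt_Zisqrt A : \rank A = k -> Zsqrt A *m Zisqrt A = 1%:M.
Proof.
move=> rkA; rewrite /Zisqrt /Zsqrt mulmx_diag; apply/matrixP => i j.
rewrite [LHS]mxE [RHS]mxE; case: eqP => [_|//].
rewrite !mulr1n mxE [X in X * _]mxE [X in _ * X]mxE divff //; apply/eqP => s0.
have A0 : forall l, A l i = 0.
  apply: Zmx_diag_eq0; apply/eqP.
  by rewrite eq_le Zmx_diag_ge0 andbT -sqrtr_eq0 s0.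
(* Full column rank gives [A^T *m B = 1]; its [(i, i)] entry would be 0 if column [i] of [A]
   vanished. *)
have /row_freeP[B AB] : row_free A^T by rewrite /row_free mxrank_tr rkA.
have /matrixP/(_ i i) := AB; rewrite !mxE eqxx big1 => [/esym/eqP|l _].
  by rewrite oner_eq0.
by rewrite mxE A0 mul0r.
Qed.

Lemma rank_Qmx A : \rank A = k -> \rank (Qmx A) = k.
Proof.
move=> rkA; apply/eqP; rewrite eqn_leq rank_leq_col /=.
by rewrite -[X in (X <= _)%N]rkA -[X in \rank X]Qmx_Zsqrt mxrankM_maxl.
Qed.

End Normalisation.

(** * Loadings of full column rank: cancellation and column spaces *)

Section Cancellation.
Variables (F : fieldType) (m k : nat) (A : 'M[F]_(m, k)).
Hypothesis rkA : \rank A = k.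

Lemma mulmx_rank_inj n : injective (fun X : 'M[F]_(k, n) => A *m X).
Proof.
move=> X Y AXY; apply: trmx_inj.
have/row_free_inj inj : row_free A^T by rewrite /row_free mxrank_tr rkA.
by apply: (inj n) => /=; rewrite -!trmx_mul AXY.
Qed.

Lemma mulmx_tr_rank_inj n : injective (fun X : 'M[F]_(n, k) => X *m A^T).
Proof. by apply: row_free_inj; rewrite /row_free mxrank_tr rkA. Qed.

End Cancellation.

Section ColumnSpace.
Variables (F : fieldType) (I : Type) (m n k l l' : nat).

Lemma loading_factor (A A' : 'M[F]_(m, k)) (X : I -> 'M[F]_(k, l))
    (X' : I -> 'M[F]_(k, l')) (B : 'M[F]_(n, l)) (B' : 'M[F]_(n, l')) :
    \rank A = k -> \rank B = l ->
    (forall u : 'rV[F]_k, (forall t, u *m X t = 0) -> u = 0) ->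
    (forall t, A' *m X' t *m B'^T = A *m X t *m B^T) ->
  exists2 N : 'M[F]_k, N \in unitmx & A' = A *m N.
Proof.
move=> rkA rkB spanX eqC.
(* The rows of [U] below span the left kernel of [A'], so the inclusion amounts to [U *m A = 0].
   Since [U] kills every common component, cancelling [B^T] shows that each row of [U *m A] kills
   every [X t]. *)
have /submxP[D AD] : (A^T <= A'^T)%MS.
  rewrite submxE; apply/eqP/trmx_inj; rewrite trmx0 trmx_mul trmxK.
  set U := (cokermx _)^T.
  have UA'0 : U *m A' = 0.
    by apply: trmx_inj; rewrite trmx_mul trmxK mulmx_coker trmx0.
  apply/row_matrixP => i; rewrite row0; apply: spanX => t.
  apply: (mulmx_tr_rank_inj rkB); rewrite /= mul0mx -!row_mul -!mulmxA.
  by rewrite [A *m _]mulmxA -eqC !mulmxA UA'0 !mul0mx row0.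
have {}AD : A = A' *m D^T by apply: trmx_inj; rewrite trmx_mul trmxK.
(* The rank [k] of [A = A' *m D^T] is at most that of the square matrix [D^T]. *)
have uD : D^T \in unitmx.
  rewrite -row_free_unit /row_free eqn_leq rank_leq_row /=.
  by rewrite -[X in (X <= _)%N]rkA AD mxrankM_maxr.
by exists (invmx D^T); rewrite ?unitmx_inv // AD mulmxK.
Qed.

End ColumnSpace.

(** * Centring and the main effects *)

Lemma ones_tr_ones (R : realType) (m : nat) :
  (ones R m)^T *m ones R m = (m%:R)%:M.
Proof.
apply/matrixP => i j; rewrite !mxE !ord1 eqxx mulr1n.
rewrite (eq_bigr (fun=> 1)) => [|l _]; last by rewrite !mxE mulr1.
by rewrite sumr_const card_ord.
Qed.

(** As [m > 0], the vector of ones is a nonzero element of the left kernel, so the rank is not [m]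
    and the minimum must be [k]. *)
Lemma centered_rank (R : realType) (m k : nat) (A : 'M[R]_(m, k)) :
  (0 < m)%N -> (ones R m)^T *m A = 0 -> \rank A = minn m k -> \rank A = k.
Proof.
move=> m_gt0 A0 rkA; have : \rank A != m.
  apply/negP => /row_free_inj inj.
  have /matrixP/(_ 0 (Ordinal m_gt0)) : (ones R m)^T = 0.
    by apply: inj; rewrite /= A0 mul0mx.
  by rewrite !mxE => /eqP; rewrite oner_eq0.
by rewrite rkA minnE; lia.
Qed.

Section MainEffects.
Variables (R : realType) (p q : nat).

(** The noiseless right-hand side of the model at one outcome; [C] is a free matrix because only its
    zero row and column sums matter for uniqueness. *)
Definition outcome (m : R) (a : 'cV[R]_p) (b : 'cV[R]_q) (C : 'M[R]_(p, q)) :=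
  m *: (ones R p *m (ones R q)^T) + a *m (ones R q)^T + ones R p *m b^T + C.

Lemma outcome_row_sums m a b C :
    (ones R q)^T *m b = 0 -> C *m ones R q = 0 ->
  outcome m a b C *m ones R q = q%:R *: (m *: ones R p + a).
Proof.
move=> b0 C0; have b0T : b^T *m ones R q = 0.
  by apply: trmx_inj; rewrite trmx_mul trmxK b0 trmx0.
rewrite /outcome !mulmxDl C0 -[_ *m b^T *m _]mulmxA b0T mulmx0 !addr0.
by rewrite -scalemxAl -!mulmxA ones_tr_ones !mul_mx_scalar scalerDr !scalerA mulrC.
Qed.

Lemma outcome_col_sums m a b C :
    (ones R p)^T *m a = 0 -> (ones R p)^T *m C = 0 ->
  (ones R p)^T *m outcome m a b C = p%:R *: (m *: ones R q + b)^T.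
Proof.
move=> a0 C0.
rewrite /outcome !mulmxDr C0 [_ *m (a *m _)]mulmxA a0 mul0mx !addr0.
rewrite -scalemxAr !mulmxA ones_tr_ones !mul_scalar_mx.
by rewrite linearD /= [(m *: _)^T]linearZ /= scalerDr !scalerA mulrC.
Qed.

Lemma outcome_inj m m' a a' b b' C C' : (0 < p)%N -> (0 < q)%N ->
    (ones R p)^T *m a = 0 -> (ones R p)^T *m a' = 0 ->
    (ones R q)^T *m b = 0 -> (ones R q)^T *m b' = 0 ->
    (ones R p)^T *m C = 0 -> (ones R p)^T *m C' = 0 ->
    C *m ones R q = 0 -> C' *m ones R q = 0 ->
    outcome m' a' b' C' = outcome m a b C ->
  [/\ m' = m, a' = a, b' = b & C' = C].
Proof.
move=> p_gt0 q_gt0 a0 a'0 b0 b'0 Cp0 C'p0 Cq0 C'q0 eqS.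
have p0 : p%:R != 0 :> R by rewrite pnatr_eq0 -lt0n.
have q0 : q%:R != 0 :> R by rewrite pnatr_eq0 -lt0n.
have rows : m' *: ones R p + a' = m *: ones R p + a.
  by apply: (scalerI q0); rewrite -(outcome_row_sums m a b0 Cq0) -eqS
    (outcome_row_sums _ _ b'0 C'q0).
have cols : m' *: ones R q + b' = m *: ones R q + b.
  by apply/trmx_inj/(scalerI p0); rewrite -(outcome_col_sums m b a0 Cp0) -eqS
    (outcome_col_sums _ _ a'0 C'p0).
(* Summing the row identity once more removes [a] and [a'] and leaves [p] times the grand means. *)
have mm : m' = m.
  have := congr1 (mulmx (ones R p)^T) rows.
  rewrite !mulmxDr a0 a'0 !addr0 -!scalemxAr ones_tr_ones !scale_scalar_mx.
  by move/matrixP/(_ 0 0); rewrite !mxE eqxx !mulr1n; apply: mulIf.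
move: rows cols; rewrite mm => /addrI aa /addrI bb.
by move: eqS; rewrite mm aa bb => /addrI CC.
Qed.

End MainEffects.

(** * From the loadings to the normalised factor structure *)

Lemma common_Qmx (Omega : Type) (R : realType) (T p q kr kc : nat)
    (th : mefm Omega R T p q kr kc) t w :
  Qr th w *m FZ th t w *m (Qc th w)^T = common th t w.
Proof.
have ZT : (Zsqrt (Ac th w))^T = Zsqrt (Ac th w) by rewrite tr_diag_mx.
rewrite /common -[in RHS](Qmx_Zsqrt (Ar th w)) -[in RHS](Qmx_Zsqrt (Ac th w)).
by rewrite [in RHS]trmx_mul ZT !mulmxA.
Qed.

Lemma Qmx_mulr_unit (R : realType) (m k : nat) (A A' : 'M[R]_(m, k)) N :
    \rank A = k -> \rank A' = k -> N \in unitmx -> A' = A *m N ->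
  exists2 M, M \in unitmx & Qmx A' = Qmx A *m M.
Proof.
(* The witness is read off from [Qmx A' = A *m N *m Zisqrt A'] and [A = Qmx A *m Zsqrt A]; full rank
   makes both diagonal factors invertible. *)
move=> rkA rkA' uN A'E; exists (Zsqrt A *m N *m Zisqrt A').
  have [uZ _] := mulmx1_unit (Zsqrt_Zisqrt rkA).
  have [_ uZ'] := mulmx1_unit (Zsqrt_Zisqrt rkA').
  by rewrite !unitmx_mul uZ uN uZ'.
by rewrite !mulmxA Qmx_Zsqrt -A'E.
Qed.

Lemma factor_structure_eq (Omega : Type) (R : realType) (T p q kr kc : nat)
    (th th' : mefm Omega R T p q kr kc) w :
    \rank (Ar th w) = kr -> \rank (Ar th' w) = kr ->
    \rank (Ac th w) = kc -> \rank (Ac th' w) = kc ->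
    factors_span th w -> (forall t, common th' t w = common th t w) ->
  exists (Mr : 'M[R]_kr) (Mc : 'M[R]_kc),
    [/\ Mr \in unitmx, Mc \in unitmx,
        Qr th' w = Qr th w *m Mr, Qc th' w = Qc th w *m Mc &
        forall t, FZ th' t w = invmx Mr *m FZ th t w *m invmx (Mc^T)].
Proof.
move=> rkr rkr' rkc rkc' [spanr spanc] eqC.
have [Nr uNr ArE] := loading_factor rkr rkc spanr eqC.
have [Nc uNc AcE] : exists2 N, N \in unitmx & Ac th' w = Ac th w *m N.
  apply: (loading_factor (X := fun t => (Ft th t w)^T)
    (X' := fun t => (Ft th' t w)^T) rkc rkr (B' := Ar th' w)) => [u u0|t].
    apply: trmx_inj; rewrite trmx0; apply: spanc => t.
    by apply: trmx_inj; rewrite trmx_mul trmxK u0 trmx0.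
  by have /(congr1 trmx) := eqC t; rewrite /common !trmx_mul !trmxK !mulmxA.
have [Mr uMr QrE] : exists2 M, M \in unitmx & Qr th' w = Qr th w *m M :=
  Qmx_mulr_unit rkr rkr' uNr ArE.
have [Mc uMc QcE] : exists2 M, M \in unitmx & Qc th' w = Qc th w *m M :=
  Qmx_mulr_unit rkc rkc' uNc AcE.
exists Mr, Mc; split => // t.
(* Both sides give the same common component between [Qr th w] and [(Qc th w)^T], which have full
   rank and cancel. *)
have FZE : Mr *m FZ th' t w *m Mc^T = FZ th t w.
  apply/(mulmx_rank_inj (rank_Qmx rkr))/(mulmx_tr_rank_inj (rank_Qmx rkc)).
  rewrite /= -/(Qr th w) -/(Qc th w) common_Qmx -eqC -common_Qmx.
  by rewrite QrE QcE (trmx_mul (Qc th w)) !mulmxA.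
by rewrite -FZE -(mulmxA Mr) mulKmx // mulmxK // unitmx_tr.
Qed.

(** * Passage to almost sure statements *)

Section AlmostSure.
Context (d : measure_display) (Omega : measurableType d) (R : realType).
Variable P : probability Omega R.
Variables (T kr kc p q : nat).
Implicit Type th : mefm Omega R T p q kr kc.

Lemma components_identified (Y E : 'I_T -> Omega -> 'M[R]_(p, q)) th th' t :
    (0 < p)%N -> (0 < q)%N ->
    satisfies_model P Y E th -> satisfies_model P Y E th' ->
    centering_condition P th -> centering_condition P th' ->
  \forall w \ae P,
    [/\ mu th' t w = mu th t w, alpha th' t w = alpha th t w,
        beta th' t w = beta th t w & common th' t w = common th t w].
Proof.
move=> p_gt0 q_gt0 [_ _ mY] [_ _ mY'] [a0 b0 Ar0 Ac0] [a0' b0' Ar0' Ac0'].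
(* Centred loadings give the common component zero column sums and, in the next claim, zero row
   sums. *)
have common_row0 (x : mefm Omega R T p q kr kc) w : (ones R p)^T *m Ar x w = 0 ->
    (ones R p)^T *m common x t w = 0.
  by move=> A0; rewrite /common !mulmxA A0 !mul0mx.
have common_col0 (x : mefm Omega R T p q kr kc) w : (ones R q)^T *m Ac x w = 0 ->
    common x t w *m ones R q = 0.
  move=> A0; rewrite /common -mulmxA; have -> : (Ac x w)^T *m ones R q = 0.
    by apply: trmx_inj; rewrite trmx_mul trmxK A0 trmx0.
  by rewrite mulmx0.
apply: filterS (filterI (filterI (filterI (mY t) (mY' t))
  (filterI (filterI (a0 t) (a0' t)) (filterI (b0 t) (b0' t))))
  (filterI (filterI Ar0 Ar0') (filterI Ac0 Ac0'))).
move=> w [[[eY eY'] [[aw aw'] [bw bw']]] [[rw rw'] [cw cw']]].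
apply: (outcome_inj p_gt0 q_gt0 aw aw' bw bw') => //.
- exact: common_row0.
- exact: common_row0.
- exact: common_col0.
- exact: common_col0.
- by apply: (addIr (E t w)); rewrite /outcome -eY -eY'.
Qed.

Lemma full_column_rank (k : nat) (m : nat -> nat)
    (A : forall n, Omega -> 'M[R]_(m n, k)) n :
    (0 < m n)%N -> regular_loadings P A ->
    (\forall w \ae P, (ones R (m n))^T *m A n w = 0) ->
  \forall w \ae P, \rank (A n w) = k.
Proof.
move=> m_gt0 [rkA _ _] A0; apply: filterS2 A0 (rkA n) => w.
exact: centered_rank.
Qed.

End AlmostSure.

Unset Implicit Arguments.

Theorem theorem1 (d : measure_display) (Omega : measurableType d) (R : realType)
    (P : probability Omega R) (T kr kc : nat) (p q : nat -> nat)
    (Y E : forall n, 'I_T -> Omega -> 'M[R]_(p n, q n))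
    (th th' : forall n, mefm Omega R T (p n) (q n) kr kc)
    (p_gt0 : forall n, (0 < p n)%N) (q_gt0 : forall n, (0 < q n)%N)
    (model : forall n, satisfies_model P (Y n) (E n) (th n))
    (model' : forall n, satisfies_model P (Y n) (E n) (th' n))
    (centered : forall n, centering_condition P (th n))
    (centered' : forall n, centering_condition P (th' n)) :
  (forall n t, \forall w \ae P,
     [/\ mu (th' n) t w = mu (th n) t w,
         alpha (th' n) t w = alpha (th n) t w,
         beta (th' n) t w = beta (th n) t w,
         common (th' n) t w = common (th n) t w &
         Qr (th' n) w *m FZ (th' n) t w *m (Qc (th' n) w)^T
         = Qr (th n) w *m FZ (th n) t w *m (Qc (th n) w)^T])
  /\
  (p @ \oo --> \oo -> q @ \oo --> \oo ->
   loading_condition P E th -> loading_condition P E th' ->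
   forall n, \forall w \ae P, factors_span (th n) w ->
     exists (Mr : 'M[R]_kr) (Mc : 'M[R]_kc),
       [/\ Mr \in unitmx,
           Mc \in unitmx,
           Qr (th' n) w = Qr (th n) w *m Mr,
           Qc (th' n) w = Qc (th n) w *m Mc &
           forall t, FZ (th' n) t w
             = invmx Mr *m FZ (th n) t w *m invmx (Mc^T)]).
Proof.
split=> [n t|_ _ [_ _ Lr Lc] [_ _ Lr' Lc'] n].
  apply: filterS (components_identified t (p_gt0 n) (q_gt0 n) (model n) (model' n)
    (centered n) (centered' n)) => w [? ? ? eqC].
  by split=> //; rewrite !common_Qmx.
have eqC : \forall w \ae P, forall t, common (th' n) t w = common (th n) t w.
  (* Time is finite, so one null set serves all [t]; hence [Mr] and [Mc] can be chosen at [w]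
     independently of [t]. *)
  apply: filter_forall => t.
  by apply: filterS (components_identified t (p_gt0 n) (q_gt0 n) (model n)
    (model' n) (centered n) (centered' n)) => w [].
have [_ _ Ar0 Ac0] := centered n; have [_ _ Ar0' Ac0'] := centered' n.
have rkr := full_column_rank (p_gt0 n) Lr Ar0.
have rkr' := full_column_rank (p_gt0 n) Lr' Ar0'.
have rkc := full_column_rank (q_gt0 n) Lc Ac0.
have rkc' := full_column_rank (q_gt0 n) Lc' Ac0'.
apply: filterS (filterI eqC (filterI (filterI rkr rkr') (filterI rkc rkc'))).
move=> w [eqCw [[? ?] [? ?]]] span; exact: factor_structure_eq.
Qed.
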